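(* Let $n \ge 2$ be an even integer and let $P_n$ be the path on $n$ vertices. Then the detour monophonic vertex cover pebbling number of $P_n$ is $$\mu_{vc}(P_n) = \sum_{i=0}^{\frac n2 - 1} 2^{2i}.$$
   Context: All graphs are finite, simple and connected. A pebbling move removes two pebbles from a vertex and places one pebble on an adjacent vertex (the other pebble is lost). A vertex cover of a graph $G$ is a set $D_{vc}\subseteq V(G)$ such that every edge of $G$ has at least one endpoint in $D_{vc}$. A detour monophonic path between two vertices $x,y$ is a longest chordless (i.e. induced) path between $x$ and $y$. The detour monophonic distance $D_m(x,y)$ is its length (number of edges), so $D_m(x,x)=0$ and $D_m(x,y)=1$ if $x,y$ are adjacent. Pebbles are transported from the source vertex only along detour monophonic paths, so bringing one pebble from a vertex $\dot s$ to a vertex $u$ uses $2^{D_m(\dot s,u)}$ pebbles of $\dot s$ (and a pebble kept on $\dot s$ itself uses one). The detour monophonic vertex cover pebbling number $\mu_{vc}(G)$ is the minimum number $m$ such that, for every choice of source vertex $\dot s\in V(G)$, if $m$ pebbles are placed on $\dot s$, then one can place at least one pebble on every vertex of some minimum-cardinality vertex cover of $G$ by transporting pebbles along detour monophonic paths. Equivalently, $$\mu_{vc}(G)=\max_{\dot s\in V(G)}\ \min_{D}\ \sum_{u\in D}2^{D_m(\dot s,u)},$$ where $D$ ranges over the vertex covers of $G$ of minimum cardinality. *)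

(* Defs.v *)
From mathcomp Require Import all_boot.

Set Implicit Arguments.
Unset Strict Implicit.
Unset Printing Implicit Defensive.

Record graph := Graph {
  vertex :> finType;
  adj : rel vertex;
  adj_sym : symmetric adj;
  adj_irrefl : irreflexive adj;
  adj_connected : forall x y : vertex, connect adj x y
}.

Arguments adj {g} _ _ : rename.

Definition path_adj (n : nat) : rel 'I_n :=
  fun i j => (i.+1 == j :> nat) || (j.+1 == i :> nat).

Lemma path_adj_sym n : symmetric (@path_adj n).
Proof. by move=> i j; rewrite /path_adj orbC. Qed.

Lemma path_adj_irrefl n : irreflexive (@path_adj n).
Proof. by move=> i; rewrite /path_adj orbb gtn_eqF. Qed.

Lemma path_adj_connected n (x y : 'I_n) : connect (@path_adj n) x y.
Proof.
have up (a b : 'I_n) : a <= b -> connect (@path_adj n) a b.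
  case: b => b; elim: b => [|b IHb] lt_b /= le_ab.
    by rewrite (_ : a = Ordinal lt_b) //; apply/val_inj/eqP; rewrite -leqn0.
  move: le_ab; rewrite leq_eqVlt => /predU1P[eq_ab | lt_ab].
    by rewrite (_ : a = Ordinal lt_b) //; apply/val_inj.
  apply: connect_trans (IHb (ltnW lt_b) lt_ab) (connect1 _).
  by rewrite /path_adj /= eqxx.
have [/up // | /ltnW/up] := leqP x y.
by rewrite (sym_connect_sym (@path_adj_sym n)).
Qed.

Definition path_graph (n : nat) : graph :=
  Graph (@path_adj_sym n) (@path_adj_irrefl n) (@path_adj_connected n).

Section DetourMonophonicVertexCoverPebbling.
Variable G : graph.
Implicit Types (x y s u : G) (p : seq G) (D : {set G}) (m k : nat).

Definition vertex_cover D : bool :=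
  [forall x, forall y, adj x y ==> (x \in D) || (y \in D)].

Definition minimum_vertex_cover D : bool :=
  vertex_cover D && [forall B : {set G}, vertex_cover B ==> (#|D| <= #|B|)].

(* The path has vertex sequence x :: p, hence length (size p).  A chord would *)
(* be an edge between two vertices that are not consecutive on it.            *)
Definition monophonic_path x p y : bool :=
  [&& path adj x p, last x p == y, uniq (x :: p) &
    [forall i : 'I_(size p).+1, forall j : 'I_(size p).+1,
      (i < j) && adj (nth x (x :: p) i) (nth x (x :: p) j) ==> (j == i.+1 :> nat)]].

(* The bound k < #|G| loses nothing: the vertices of a path are distinct.     *)
Definition detour_monophonic_distance x y : nat :=
  \max_(k < #|G| | [exists p : k.-tuple G, monophonic_path x p y]) k.

Definition detour_monophonic_path x p y : bool :=
  monophonic_path x p y && (size p == detour_monophonic_distance x y).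

Definition config := {ffun G -> nat}.

Definition pile s k : config := [ffun z => if z == s then k else 0].

Definition pebbling_move x y (c c' : config) : Prop :=
  [/\ adj x y, 2 <= c x &
      c' = [ffun z => if z == x then c z - 2
                      else if z == y then c z + 1 else c z]].

(* zip (x :: p) p lists the pairs of consecutive vertices of the path x :: p, *)
(* so pebbles only advance along it.                                          *)
Inductive moves_along x p : config -> config -> Prop :=
| moves_refl c : moves_along x p c c
| moves_step c c' c'' a b :
    (a, b) \in zip (x :: p) p ->
    pebbling_move a b c c' -> moves_along x p c' c'' -> moves_along x p c c''.

Definition can_bring_pebble s u k : Prop :=
  exists p (c : config),
    [/\ detour_monophonic_path s p u, moves_along s p (pile s k) c & 1 <= c u].

(* Each target is supplied from s by a transport of its own: the pebbles of s *)
(* are split into a u pebbles for each u, with no pooling on the way, so that *)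
(* each u in D costs 2 ^ D_m(s, u) of the m pebbles (one pebble if u = s).    *)
Definition vc_solvable_from s m : Prop :=
  exists D (a : G -> nat),
    [/\ minimum_vertex_cover D,
        forall u, u \in D -> can_bring_pebble s u (a u) &
        \sum_(u in D) a u <= m].

(* The number is unique when it exists, so this relation stands for           *)
(* mu_vc(G) = m.                                                              *)
Definition is_detour_monophonic_vc_pebbling_number m : Prop :=
  (forall s, vc_solvable_from s m) /\
  (forall k, (forall s, vc_solvable_from s k) -> m <= k).

End DetourMonophonicVertexCoverPebbling.

(* Main.v *)
Require Import Defs.
From mathcomp Require Import all_boot.
From mathcomp Require Import zify.

Set Implicit Arguments.
Unset Strict Implicit.
Unset Printing Implicit Defensive.

(** Write [n = 2h] and group the vertices [0, ..., 2h - 1] into the consecutive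
pairs [{2i, 2i+1}].  Each pair is an edge, so a vertex cover meets every pair;
hence it has at least [h] vertices, and a cover meeting each pair exactly once
is minimum ([vertex_cover_sum_ge], used with the constant weight [1]).

Lower bound: take the source [0].  The weight that gives [2 ^ z] to a pebble
on the vertex [z] never increases under a pebbling move, so a pebble on [u]
costs at least [2 ^ u] pebbles of [0].  A cover contains a vertex [u >= 2i] of
the [i]-th pair, so its total cost is at least the sum of the [2 ^ (2i)].

Upper bound: in a path graph a walk without repetition never turns back
([uniq_path_monotone]), so the detour monophonic distance is [|u - s|].  From
a source [s], use the cover made of the odd vertices up to [s] and the even
vertices from [s] on; it contains, in each pair, the vertex closer to [s].
Let [a = s./2] be the pair of [s].  The pairs [i <= a] are within distance
[2 (a - i)] of [s], so together they cost at most the sum of the [2 ^ (2i)]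
over [i <= a], read backwards; a pair [i > a] is at distance [2i - s <= 2i].
The total is therefore at most the sum of all the [2 ^ (2i)]
([near_cover_cost_le]). *)

(** * Transporting pebbles in a graph *)

Section Transport.
Variable G : graph.
Implicit Types (x y s u : G) (p q : seq G) (c : config G).

Lemma moves_along_trans x p c1 c2 c3 :
  moves_along x p c1 c2 -> moves_along x p c2 c3 -> moves_along x p c1 c3.
Proof.
elim=> [//|d d' d'' a b ab_p move_ab _ IH] /IH.
exact: moves_step move_ab.
Qed.

Lemma moves_along_cons x y p c c' :
  moves_along y p c c' -> moves_along x (y :: p) c c'.
Proof.
elim=> [d|d d' d'' a b ab_p move_ab _ IH]; first exact: moves_refl.
by apply: moves_step move_ab IH; rewrite /= inE ab_p orbT.
Qed.

Lemma repeat_move x p a b m c :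
    (a, b) \in zip (x :: p) p -> adj a b -> 2 * m <= c a ->
  exists2 c', moves_along x p c c' & c b + m <= c' b.
Proof.
move=> ab_p adj_ab; elim: m c => [|m IHm] c le_c.
  by exists c; [exact: moves_refl | rewrite addn0].
have neq_ba : b != a by apply: contraTneq adj_ab => ->; rewrite adj_irrefl.
pose d : config G := [ffun z => if z == a then c z - 2
                      else if z == b then c z + 1 else c z].
have [|c' moves_dc' le_c'] := IHm d; first by rewrite ffunE eqxx; lia.
exists c'; first by apply: (moves_step ab_p _ moves_dc'); split=> //; lia.
by move: le_c'; rewrite ffunE (negPf neq_ba) eqxx; lia.
Qed.

Lemma bring_along_path x p c :
    path adj x p -> 2 ^ size p <= c x ->
  exists2 c', moves_along x p c c' & 0 < c' (last x p).
Proof.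
elim: p x c => [|y p IHp] x c /=; first by exists c => //; exact: moves_refl.
case/andP=> adj_xy path_p; rewrite expnS => le_cx.
have xy_p : (x, y) \in zip (x :: y :: p) (y :: p) by rewrite inE eqxx.
have [d moves_cd le_d] := @repeat_move x (y :: p) x y _ c xy_p adj_xy le_cx.
have [|c' moves_dc' gt0_c'] := IHp y d path_p; first by lia.
exists c' => //; apply: moves_along_trans moves_cd _.
exact: moves_along_cons.
Qed.

(** A move trades two pebbles on [a] for one on [b], so the total weight
cannot grow when adjacent vertices have weights within a factor [2]. *)
Lemma weight_moves_along (w : G -> nat) x p c c' :
    (forall a b : G, adj a b -> w b <= 2 * w a) -> moves_along x p c c' ->
  \sum_z c' z * w z <= \sum_z c z * w z.
Proof.
move=> w_adj; elim=> [//|d d' d'' a b _ [adj_ab ge2_da ->] _ IH].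
apply: leq_trans IH _.
have neq_ba : b != a by apply: contraTneq adj_ab => ->; rewrite adj_irrefl.
rewrite (bigD1 a) // (bigD1 b) //= [leqRHS](bigD1 a) //.
rewrite [X in _ <= _ + X](bigD1 b) //=.
rewrite !ffunE !eqxx (negPf neq_ba) !addnA leq_add //; last first.
  by apply: leq_sum => z /andP[/negPf neq_za /negPf neq_zb];
    rewrite ffunE neq_za neq_zb.
by have := w_adj _ _ adj_ab; nia.
Qed.

Lemma bring_pebble_weight (w : G -> nat) s u k :
    (forall a b : G, adj a b -> w b <= 2 * w a) -> can_bring_pebble s u k ->
  w u <= k * w s.
Proof.
move=> w_adj [p [c [_ moves_c gt0_cu]]].
have -> : k * w s = \sum_z pile s k z * w z.
  rewrite (bigD1 s) //= ffunE eqxx big1 ?addn0 // => z /negPf neq_zs.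
  by rewrite ffunE neq_zs.
apply: leq_trans (weight_moves_along w_adj moves_c).
by rewrite (bigD1 u) //= -[leqLHS]addn0 leq_add // leq_pmull.
Qed.

Lemma detour_of_size_eq x p y :
    monophonic_path x p y ->
    (forall q, monophonic_path x q y -> size q = size p) ->
  detour_monophonic_path x p y.
Proof.
move=> mono_p size_p; rewrite /detour_monophonic_path mono_p /= eqn_leq.
apply/andP; split; last first.
  by apply/bigmax_leqP => k /existsP[q /size_p]; rewrite size_tuple => ->.
have lt_p : size p < #|G|.
  by case/and4P: mono_p => _ _ /card_uniqP /= <- _; exact: max_card.
have ex_p : [exists q : (Ordinal lt_p).-tuple G, monophonic_path x q y].
  by apply/existsP; exists (in_tuple p).
exact: (leq_bigmax_cond (F := fun k : 'I__ => k : nat) (Ordinal lt_p) ex_p).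
Qed.

Lemma can_bring_detour s p u :
  detour_monophonic_path s p u -> can_bring_pebble s u (2 ^ size p).
Proof.
move=> detour_p; have /andP[/and4P[path_p /eqP last_p _ _] _] := detour_p.
have [|c moves_c gt0_c] := @bring_along_path s p (pile s (2 ^ size p)) path_p.
  by rewrite ffunE eqxx.
by exists p, c; split; rewrite // -last_p.
Qed.

End Transport.

(** * Detour monophonic paths of a path graph *)

Lemma uniq_path_monotone n (x : 'I_n) (p : seq 'I_n) :
    path (@path_adj n) x p -> uniq (x :: p) ->
  (forall i, i <= size p -> nth x (x :: p) i = x + i :> nat) \/
  (forall i, i <= size p -> nth x (x :: p) i + i = x :> nat).
Proof.
elim: p x => [|y p IHp] x /=.
  by left=> i; rewrite leqn0 => /eqP->; rewrite addn0.
case/andP=> adj_xy path_p; rewrite inE negb_or -andbA.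
case/and3P=> neq_xy notin_xp uniq_p.
have nthE i : i <= size p -> nth x (y :: p) i = nth y (y :: p) i.
  by move=> le_i; exact: set_nth_default.
(* The second step cannot return to [x], so it goes the way of the first. *)
have step1 : 0 < size p -> nth y (y :: p) 1 <> x :> nat.
  case: (p) notin_xp => //= z q + _ eq_zx.
  by rewrite -(val_inj eq_zx) inE eqxx.
have [/size0nil ->|p_gt0] := posnP (size p).
  by case/orP: adj_xy => /eqP eq_xy; [left|right];
    case=> [|[|i]] //= _; lia.
have := step1 p_gt0; have [up|down] := IHp y path_p uniq_p.
- rewrite (up 1) // => neq1; left=> -[|i] /=; first by rewrite addn0.
  rewrite ltnS => le_i; rewrite nthE // up //.
  by move: adj_xy; rewrite /path_adj; lia.
- have := down 1 p_gt0 => eq1 neq1; right=> -[|i] /=; first by rewrite addn0.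
  rewrite ltnS => le_i; rewrite nthE //; have := down i le_i.
  by move: adj_xy; rewrite /path_adj; lia.
Qed.

Lemma size_uniq_path n (x : 'I_n) (p : seq 'I_n) :
    path (@path_adj n) x p -> uniq (x :: p) ->
  size p = (last x p - x) + (x - last x p).
Proof.
move=> path_p uniq_p; rewrite (last_nth x).
by have [/(_ _ (leqnn _))|/(_ _ (leqnn _))] := uniq_path_monotone path_p uniq_p; lia.
Qed.

(** Vertices at positions [i] and [j] of a monotone path differ by [j - i], so
only consecutive ones can be adjacent. *)
Lemma uniq_path_monophonic n (x : path_graph n) (p : seq (path_graph n)) :
  path adj x p -> uniq (x :: p) -> monophonic_path x p (last x p).
Proof.
move=> path_p uniq_p; rewrite /monophonic_path path_p eqxx uniq_p /=.
apply/forallP=> i; apply/forallP=> j; apply/implyP=> /andP[lt_ij].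
have [le_i le_j] := (ltn_ord i, ltn_ord j).
rewrite /path_adj.
have [mono|mono] := uniq_path_monotone path_p uniq_p;
  by have := (mono i le_i, mono j le_j); case; lia.
Qed.

Lemma can_bring_path_graph n (s u : path_graph n) :
  can_bring_pebble s u (2 ^ ((u - s) + (s - u))).
Proof.
have /connectP[p0 path_p0 ->] := adj_connected s u.
case/shortenP: path_p0 => p path_p uniq_p _.
rewrite -size_uniq_path //.
apply/can_bring_detour/detour_of_size_eq; first exact: uniq_path_monophonic.
move=> q /and4P[path_q /eqP last_q uniq_q _].
by rewrite (size_uniq_path path_q uniq_q) last_q -size_uniq_path.
Qed.

(** * Vertex covers of a path graph with an even number of vertices *)

Lemma sum_pairs h (F : nat -> nat) :
  \sum_(0 <= u < h.*2) F u = \sum_(0 <= i < h) (F i.*2 + F i.*2.+1).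
Proof.
elim: h => [|h IHh]; first by rewrite !big_geq.
by rewrite doubleS !big_nat_recr //= IHh addnA.
Qed.

(** Each edge [{2i, 2i+1}] puts into [D] a vertex of weight at least [w (2i)].
A constant [w] bounds the cardinality of [D], and [w = 2 ^ _] its cost from
the end vertex [0]. *)
Lemma vertex_cover_sum_ge h (w : nat -> nat) (D : {set path_graph h.*2}) :
    {homo w : i j / i <= j} -> vertex_cover D ->
  \sum_(0 <= i < h) w i.*2 <= \sum_(u in D) w (u : 'I_h.*2).
Proof.
move=> w_mono cover_D.
pose inD v := [exists u in D, val (u : 'I_h.*2) == v].
have inDE (u : 'I_h.*2) : inD u = (u \in D).
  apply/existsP/idP => [[v /andP[v_D /eqP/val_inj <-]] // | u_D].
  by exists u; rewrite u_D eqxx.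
have -> : \sum_(u in D) w (u : 'I_h.*2) = \sum_(0 <= u < h.*2 | inD u) w u.
  by rewrite big_mkord; apply: eq_bigl => u; rewrite inDE.
rewrite [leqRHS]big_mkcond sum_pairs /=.
rewrite big_nat [leqRHS]big_nat; apply: leq_sum => i lt_ih.
have lt0 : i.*2 < h.*2 by lia.
have lt1 : i.*2.+1 < h.*2 by lia.
move/forallP/(_ (Ordinal lt0))/forallP/(_ (Ordinal lt1)): cover_D.
rewrite /= /path_adj eqxx /= -!inDE /=.
case: (inD i.*2) => [_|/= ->]; first exact: leq_addr.
by rewrite add0n w_mono.
Qed.

(** The vertices of each pair [{2i, 2i+1}] closer to [s], in closed form. *)
Definition near_cover n (s : 'I_n) : {set path_graph n} :=
  [set u : 'I_n | if odd u then u <= s else s <= u].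

Lemma near_cover_vertex_cover n (s : 'I_n) : vertex_cover (near_cover s).
Proof.
apply/forallP=> x; apply/forallP=> y; apply/implyP; rewrite !inE /= /path_adj.
by case/orP=> /eqP eq_xy; rewrite -eq_xy /=; case: (odd _) => /=; lia.
Qed.

Lemma sum_near_cover h (s : 'I_h.*2) (F : nat -> nat) :
  \sum_(u in near_cover s) F (u : 'I_h.*2) =
  \sum_(0 <= i < h) F (i.*2 + (i.*2 < s)).
Proof.
under eq_bigl do rewrite inE.
rewrite -(big_mkord (fun u => if odd u then u <= s else s <= u)).
rewrite big_mkcond sum_pairs; apply: eq_bigr => i _ /=.
rewrite odd_double /=; case: ltnP => _; first by rewrite addn1.
by rewrite !addn0.
Qed.

Lemma near_cover_minimum h (s : 'I_h.*2) : minimum_vertex_cover (near_cover s).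
Proof.
rewrite /minimum_vertex_cover near_cover_vertex_cover /=.
apply/forallP=> B; apply/implyP=> cover_B.
rewrite -!sum1_card (@sum_near_cover h s (fun=> 1)).
exact: (@vertex_cover_sum_ge h (fun=> 1)).
Qed.

Lemma near_cover_cost_le h (s : 'I_h.*2) :
  \sum_(u in near_cover s) 2 ^ (((u : 'I_h.*2) - s) + (s - (u : 'I_h.*2))) <=
  \sum_(0 <= i < h) 2 ^ (2 * i).
Proof.
rewrite (@sum_near_cover h s (fun u => 2 ^ ((u - s) + (s - u)))).
have lt_s := ltn_ord s.
have le_h : s./2.+1 <= h by lia.
rewrite (big_cat_nat (leq0n _) le_h) //= [leqRHS](big_cat_nat (leq0n _) le_h) //=.
apply: leq_add; last first.
  rewrite big_nat [leqRHS]big_nat; apply: leq_sum => i lt_i.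
  by rewrite leq_pexp2l //; lia.
(* Up to the pair [s./2], the [i]-th one is matched with [4 ^ (s./2 - i)]. *)
rewrite [leqRHS]big_nat_rev /= big_nat [leqRHS]big_nat; apply: leq_sum => i lt_i.
by rewrite leq_pexp2l //; lia.
Qed.

Theorem theorem2p2 (n : nat) (n_ge2 : 2 <= n) (n_even : ~~ odd n) :
  is_detour_monophonic_vc_pebbling_number (path_graph n)
    (\sum_(0 <= i < n./2) 2 ^ (2 * i)).
Proof.
have [h def_n] : exists h, n = h.*2 by exists n./2; rewrite even_halfK.
subst n; rewrite doubleK; split=> [s | k solvable_k].
  exists (near_cover s), (fun u : 'I_h.*2 => 2 ^ ((u - s) + (s - u))); split.
  - exact: near_cover_minimum.
  - by move=> u _; exact: can_bring_path_graph.
  - exact: near_cover_cost_le.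
have lt0 : 0 < h.*2 by lia.
have [D [a [/andP[cover_D _] bring_D le_k]]] := solvable_k (Ordinal lt0).
apply: leq_trans le_k.
under eq_bigr do rewrite mul2n.
have exp2_mono : {homo expn 2 : i j / i <= j} by move=> i j; exact: leq_pexp2l.
apply: leq_trans (vertex_cover_sum_ge exp2_mono cover_D) _.
pose w (z : path_graph h.*2) := 2 ^ (z : 'I_h.*2).
apply: leq_sum => u /bring_D/(@bring_pebble_weight _ w).
(* The source [0] has weight [2 ^ 0 = 1]. *)
rewrite /w /= muln1; apply=> x y adj_xy.
by rewrite -expnS leq_pexp2l //; move: adj_xy; rewrite /= /path_adj; lia.
Qed.
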